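(* Let $\mathcal{N}$ carry the subspace topology induced by the fine very strong topology on $C^\infty(\mathbb{R}\times\mathbb{S}^2,\mathbb{R})$. Then the unit component of the group $\mathcal{N}$, i.e. the connected component of $\mathcal{N}$ containing the unit $p\colon (t,\mathbf{z})\mapsto t$, coincides with $\mathcal{N}_c$.
   Context: $\mathbb{S}^2$ is the 2-sphere, and $C^\infty(\mathbb{R}\times\mathbb{S}^2) = C^\infty(\mathbb{R}\times\mathbb{S}^2,\mathbb{R})$ is the set of smooth real-valued functions. $\mathrm{Diff}^+(\mathbb{R})$ is the group of smooth orientation-preserving diffeomorphisms of $\mathbb{R}$ (smooth diffeomorphisms $\mathbb{R}\to\mathbb{R}$ with everywhere positive derivative). Define $\mathcal{N} = \{F \in C^\infty(\mathbb{R}\times\mathbb{S}^2) \mid F(\cdot,\mathbf{z}) \in \mathrm{Diff}^+(\mathbb{R}) \text{ for all } \mathbf{z}\in\mathbb{S}^2\}$. It is a group with product $(F\cdot G)(u,\mathbf{z}) = F(G(u,\mathbf{z}),\mathbf{z})$, unit $p\colon \mathbb{R}\times\mathbb{S}^2\to\mathbb{R}$, $p(t,\mathbf{z}) = t$, and inverse $F^{-1}(\cdot,\mathbf{z}) = F(\cdot,\mathbf{z})^{-1}$. Define $\mathcal{N}_c = \{F\in\mathcal{N} \mid \exists K\subseteq \mathbb{R}\times\mathbb{S}^2 \text{ compact such that } F(t,\mathbf{z}) = t \text{ for all } (t,\mathbf{z})\notin K\}$. Fine very strong topology on $C^\infty(X,\mathbb{R})$ for a finite-dimensional (second countable, Hausdorff)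 smooth manifold $X$: The very strong topology has as a basis the sets consisting of all $h\in C^\infty(X,\mathbb{R})$ such that for all $i\in I$ and all $0\le k\le r_i$, $\sup_{a\in A_i}\|D^{k}(h\circ\varphi_i^{-1})(\varphi_i(a)) - D^{k}(f\circ\varphi_i^{-1})(\varphi_i(a))\| < \varepsilon_i$; here $f\in C^\infty(X,\mathbb{R})$, $(A_i)_{i\in I}$ is any locally finite family of compact subsets of $X$, each $A_i$ is contained in the domain of a chart $(U_i,\varphi_i)$ of $X$, and $r_i\in\mathbb{N}_0$, $\varepsilon_i>0$ are arbitrary for each $i\in I$. The fine very strong topology is the coarsest topology which is finer than the very strong topology and for which every set $\{h\in C^\infty(X,\mathbb{R}) \mid \{x\in X: h(x)\neq f(x)\} \text{ is contained in a compact subset of } X\}$, $f\in C^\infty(X,\mathbb{R})$, is open. *)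

(* Defs.v *)
From HB Require Import structures.
From mathcomp Require Import all_boot all_order all_algebra.
From mathcomp Require Import all_classical all_reals all_analysis.
From mathcomp Require Import ring.

Set Implicit Arguments.
Unset Strict Implicit.
Unset Printing Implicit Defensive.

Import Order.TTheory GRing.Theory Num.Theory.
Import numFieldNormedType.Exports.

Local Open Scope classical_set_scope.
Local Open Scope ring_scope.

Section iterated_derivatives.
Context {R : realType}.

(* [iterD [:: v1; ...; vk] f x] is D_v1 (D_v2 (... (D_vk f))) x; for smooth f
   this is the k-th derivative of f at x, a symmetric k-linear map, applied to
   (v1, ..., vk). *)
Fixpoint iterD {V W : normedModType R} (vs : seq V) (f : V -> W) : V -> W :=
  if vs is v :: vs' then fun x => 'D_v (iterD vs' f) x else f.

(* Infinite differentiability on an open subset D of a finite-dimensional V;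
   the values of f outside D are irrelevant. *)
Definition smooth_on {V W : normedModType R} (D : set V) (f : V -> W) : Prop :=
  forall vs x, D x -> differentiable (iterD vs f) x.

Definition kderiv {V W : normedModType R} (k : nat) (f : V -> W) (x : V) :
    k.-tuple V -> W :=
  fun vs => iterD vs f x.

(* Operator norm of a k-linear map; for k = 0 it is the norm of the value. *)
Definition multilin_norm {V W : normedModType R} (k : nat)
    (L : k.-tuple V -> W) : \bar R :=
  ereal_sup [set `|L vs|%:E | vs in
    [set vs : k.-tuple V | forall i, `|tnth vs i| <= 1]].

End iterated_derivatives.


Section smooth_on_theory.
Context {R : realType}.
Implicit Types V W : normedModType R.

Lemma near_eq_differentiable V W (f g : V -> W) (x : V) :
  {near x, f =1 g} -> differentiable f x -> differentiable g x.
Proof.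
move=> fg df; pose h : V -> W := g - f.
have -> : g = f + h by rewrite /h addrCA subrr addr0.
apply: differentiableD => //.
pose z : {linear V -> W} := \0.
have h0 : \forall y \near x, h y = 0.
  by near=> y; rewrite /h/= fctE; apply/eqP; rewrite subr_eq0; apply/eqP/esym;
     near: y.
have hz : h \o shift x = cst (h x) + z +o_ 0 id.
  apply: eqaddoE; apply/eqaddoP => _/posnumP[e].
  have : \forall y \near (0 : V), h (y + x) = 0.
    by have := h0; rewrite (near_shift 0) subr0.
  apply: filterS => y /= hy; rewrite !fctE /= hy (nbhs_singleton h0).
  by rewrite addr0 subr0 normr0 mulr_ge0.
apply/diff_locallyP; rewrite (diff_unique _ hz); last exact: cst_continuous.
by split => //; exact: cst_continuous.
Unshelve. all: by end_near. Qed.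

(* Differentiability of f and of its iterated directional derivatives up to
   order k; it serves to prove smoothness by induction, see smooth_onP. *)
Fixpoint Ck {V W : normedModType R} (k : nat) (D : set V) (f : V -> W) : Prop :=
  (forall x, D x -> differentiable f x) /\
  (if k is k'.+1 then forall v, Ck k' D (fun x => 'D_v f x) else True).

Lemma Ck_diff V W k (D : set V) (f : V -> W) x :
  Ck k D f -> D x -> differentiable f x.
Proof. by case: k => [|k] [] /(_ x). Qed.

Lemma CkS V W k (D : set V) (f : V -> W) : Ck k.+1 D f -> Ck k D f.
Proof. by elim: k f => [|k IH] f [df kf]; split => // v; exact: IH. Qed.

Lemma iterD_rcons V W (vs : seq V) v (f : V -> W) :
  iterD (rcons vs v) f = iterD vs (fun x => 'D_v f x).
Proof. by elim: vs => //= u vs ->. Qed.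

Lemma smooth_onP V W (D : set V) (f : V -> W) :
  smooth_on D f <-> forall k, Ck k D f.
Proof.
split=> [+ k|+ vs].
  elim: k f => [|k IH] f sf; split=> //; try by move=> x; exact: (sf [::]).
  by move=> v; apply: IH => vs; rewrite -iterD_rcons; exact: sf.
elim/last_ind: vs f => [|vs v IH] f cf x Dx; first exact: Ck_diff (cf 0%N) Dx.
by rewrite iterD_rcons; apply: IH => // k; have [_] := cf k.+1; apply.
Qed.

Lemma open_near V (D : set V) x (P : V -> Prop) :
  open D -> D x -> (forall y, D y -> P y) -> \forall y \near x, P y.
Proof. by move=> oD Dx H; apply: filterS H _; exact: open_nbhs_nbhs. Qed.

Lemma Ck_eq V W k (D : set V) (f g : V -> W) :
  open D -> (forall x, D x -> f x = g x) -> Ck k D f -> Ck k D g.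
Proof.
move=> oD; elim: k f g => [|k IH] f g fg [df kf]; split=> //.
- by move=> x Dx; apply: near_eq_differentiable (df x Dx); exact: open_near fg.
- by move=> x Dx; apply: near_eq_differentiable (df x Dx); exact: open_near fg.
- move=> v; apply: IH (kf v) => x Dx; apply: near_eq_derive.
  exact: open_near fg.
Qed.

Lemma smooth_on_eq V W (D : set V) (f g : V -> W) :
  open D -> (forall x, D x -> f x = g x) -> smooth_on D f -> smooth_on D g.
Proof.
by move=> oD fg /smooth_onP cf; apply/smooth_onP => k; exact: Ck_eq (cf k).
Qed.

Lemma Ck_cst V W k (D : set V) (a : W) : Ck k D (fun=> a).
Proof.
elim: k a => [|k IH] a; split => //; do ?by move=> x _; exact: differentiable_cst.
move=> v; have -> : (fun x : V => 'D_v (fun=> a) x) = fun=> 0.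
  by apply/funext => x; exact: derive_cst.
exact: IH.
Qed.

Lemma CkD V W k (D : set V) (f g : V -> W) : open D ->
  Ck k D f -> Ck k D g -> Ck k D (fun x => f x + g x).
Proof.
move=> oD; elim: k f g => [|k IH] f g [df kf] [dg kg]; split => //;
  do ?by move=> x Dx; apply: differentiableD; [exact: df|exact: dg].
move=> v; apply: Ck_eq (IH _ _ (kf v) (kg v)) => // x Dx.
by rewrite -deriveD //; apply: diff_derivable; do ?[exact: df|exact: dg].
Qed.

Lemma Ck_sum V W k (D : set V) n (f : 'I_n -> V -> W) : open D ->
  (forall i, Ck k D (f i)) -> Ck k D (fun x => \sum_i f i x).
Proof.
move=> oD; elim: n f => [|n IH] f cf.
  by under eq_fun do rewrite big_ord0; exact: Ck_cst.
by under eq_fun do rewrite big_ord_recr /=; apply: CkD => //; exact: IH.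
Qed.

Lemma CkM V k (D : set V) (f g : V -> R) : open D ->
  Ck k D f -> Ck k D g -> Ck k D (fun x => f x * g x).
Proof.
move=> oD; elim: k f g => [|k IH] f g.
  move=> [df _] [dg _]; split => // x Dx.
  by apply: differentiableM; [exact: df|exact: dg].
move=> cf cg; have [df kf] := cf; have [dg kg] := cg; split.
  by move=> x Dx; apply: differentiableM; [exact: df|exact: dg].
move=> v; apply: Ck_eq (CkD oD (IH _ _ (CkS cf) (kg v))
                               (IH _ _ (CkS cg) (kf v))) => // x Dx.
by rewrite deriveM //; apply: diff_derivable; do ?[exact: df|exact: dg].
Qed.

Lemma CkV V k (D : set V) (f : V -> R) : open D ->
  (forall x, D x -> f x != 0) -> Ck k D f -> Ck k D (fun x => (f x)^-1).
Proof.
move=> oD f0; elim: k => [|k IH].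
  by move=> [df _]; split => // x Dx; apply: differentiableV; [exact: df|exact: f0].
move=> cf; have [df kf] := cf; split.
  by move=> x Dx; apply: differentiableV; [exact: df|exact: f0].
move=> v; have ci := IH (CkS cf).
have := CkM oD (Ck_cst k D (-1 : R)) (CkM oD (CkM oD ci ci) (kf v)).
apply: Ck_eq => // x Dx.
rewrite deriveV ?f0 //; last exact/diff_derivable/df.
by rewrite /GRing.scale /= mulN1r mulNr expr2 invfM.
Qed.

Lemma Ck_linear_comp (U : normedModType R) V W k (D : set U) (f : {linear V -> W}) (g : U -> V) :
  open D -> continuous f -> Ck k D g -> Ck k D (fun x => f (g x)).
Proof.
move=> oD cf; have df x : differentiable f x by exact: linear_differentiable.
elim: k g => [|k IH] g [dg kg]; split => //;
  do ?by move=> x Dx; apply: (differentiable_comp (dg x Dx)).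
move=> v; apply: Ck_eq (IH _ (kg v)) => // x Dx.
have dgx := dg x Dx.
rewrite [RHS]deriveE; last exact: (differentiable_comp dgx).
by rewrite (diff_comp dgx) //= diff_lin // deriveE.
Qed.

Lemma Ck_id V k (D : set V) : Ck k D (fun x => x).
Proof.
case: k => [|k]; split => //; do ?by move=> x _; exact: differentiable_id.
move=> v; have -> : (fun x : V => 'D_v (fun x : V => x) x) = fun=> v.
  by apply/funext => x; exact: derive_id.
exact: Ck_cst.
Qed.

Lemma Ck_coord V n k (D : set V) (f : V -> 'rV[R]_n) j : open D ->
  Ck k D f -> Ck k D (fun x => f x 0 j).
Proof.
move=> oD; have @c : {linear 'rV[R]_n -> R}.
  by exists (fun N : 'rV[R]_n => N 0 j); do 2![eexists]; do ?[constructor];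
     rewrite ?mxE// => ? *; rewrite ?mxE//; move=> ?; rewrite !mxE.
by apply: (@Ck_linear_comp _ _ _ k D c) => //; exact: coord_continuous.
Qed.

Lemma Ck_scalel V W k (D : set V) (f : V -> R) (w : W) : open D ->
  Ck k D f -> Ck k D (fun x => f x *: w).
Proof.
move=> oD.
have sl : linear (fun r : R => r *: w) by move=> a b c; rewrite scalerDl scalerA.
pose c : {linear R -> W} := HB.pack (fun r : R => r *: w)
  (GRing.isLinear.Build _ _ _ _ _ sl).
by apply: (@Ck_linear_comp _ _ _ k D c) => //; exact: scalel_continuous.
Qed.

Lemma Ck_mx V n k (D : set V) (f : V -> 'rV[R]_n) : open D ->
  (forall j, Ck k D (fun x => f x 0 j)) -> Ck k D f.
Proof.
move=> oD cf.
rewrite (_ : f = fun x => \sum_j f x 0 j *: delta_mx 0 j).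
  by apply: Ck_sum => // j; exact: Ck_scalel.
by apply/funext => x; exact: row_sum_delta.
Qed.

Lemma smooth_on_coord V n (D : set V) (f : V -> 'rV[R]_n) j : open D ->
  smooth_on D f -> smooth_on D (fun x => f x 0 j).
Proof.
by move=> oD /smooth_onP cf; apply/smooth_onP => k; exact: Ck_coord.
Qed.

End smooth_on_theory.

Section manifolds.
Context {R : realType}.

(* The chart is the homeomorphism chart_map from chart_dom onto its image; only
   the values of chart_map on chart_dom and of chart_inv on that image matter. *)
Record chart (n : nat) (X : topologicalType) := Chart {
  chart_dom : set X;
  chart_map :> X -> 'rV[R]_n;
  chart_inv : 'rV[R]_n -> X;
  chart_dom_open : open chart_dom;
  chart_cod_open : open (chart_map @` chart_dom);
  chart_mapK : forall x, chart_dom x -> chart_inv (chart_map x) = x;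
  chart_map_continuous : {within chart_dom, continuous chart_map};
  chart_inv_continuous :
    {within chart_map @` chart_dom, continuous chart_inv} }.

Definition chart_cod n (X : topologicalType) (c : chart n X) : set 'rV[R]_n :=
  c @` chart_dom c.

Definition smooth_transition n (X : topologicalType) (c d : chart n X) :=
  smooth_on (c @` (chart_dom c `&` chart_dom d)) (d \o chart_inv c).

Record smooth_atlas (n : nat) (X : topologicalType) := SmoothAtlas {
  atlas_charts : set (chart n X);
  atlas_cover : \bigcup_(c in atlas_charts) chart_dom c = setT;
  atlas_compat : forall c d, atlas_charts c -> atlas_charts d ->
    smooth_transition c d }.

(* The charts of the manifold: the maximal atlas containing A. *)
Definition maximal_atlas n (X : topologicalType) (A : smooth_atlas n X) :
    set (chart n X) :=
  [set c | forall d, atlas_charts A d ->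
     smooth_transition c d /\ smooth_transition d c].

Definition smooth_function n (X : topologicalType) (A : smooth_atlas n X)
    (h : X -> R) : Prop :=
  forall c, maximal_atlas A c -> smooth_on (chart_cod c) (h \o chart_inv c).

Record Cinfty n (X : topologicalType) (A : smooth_atlas n X) := MkCinfty {
  Cinfty_fun :> X -> R;
  Cinfty_smooth : smooth_function A Cinfty_fun }.

End manifolds.

Section fine_very_strong_topology.
Context {R : realType} (n : nat) (X : topologicalType).
Variable A : @smooth_atlas R n X.

Definition locally_finite (I : Type) (K : I -> set X) : Prop :=
  forall x : X, exists2 U, nbhs x U & finite_set [set i | K i `&` U !=set0].

(* sup over a in K of ||D^k(h o c^-1)(c a) - D^k(f o c^-1)(c a)||; it is -oo
   when K is empty. *)
Definition deriv_dist (K : set X) (c : @chart R n X) (k : nat) (h f : X -> R) :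
    \bar R :=
  ereal_sup [set multilin_norm (fun vs : k.-tuple 'rV[R]_n =>
      kderiv (h \o chart_inv c) (c a) vs -
      kderiv (f \o chart_inv c) (c a) vs) | a in K].

Definition vs_basic (B : set (Cinfty A)) : Prop :=
  exists (f : Cinfty A) (I : Type) (K : I -> set X) (c : I -> @chart R n X)
         (r : I -> nat) (e : I -> R),
    [/\ locally_finite K,
        forall i, [/\ compact (K i), maximal_atlas A (c i),
                      K i `<=` chart_dom (c i) & 0 < e i]
      & B = [set h | forall i k, (k <= r i)%N ->
                     (deriv_dist (K i) (c i) k h f < (e i)%:E)%E] ].

Lemma multilin_norm_le0 (V W : normedModType R) k (L : k.-tuple V -> W) :
  (forall vs, L vs = 0) -> (multilin_norm L <= 0)%E.
Proof.
by move=> L0; apply: ge_ereal_sup => _ [vs _ <-]; rewrite L0 normr0.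
Qed.

Lemma multilin_norm_triangle (V W : normedModType R) k
    (L M N : k.-tuple V -> W) : (forall vs, L vs = M vs + N vs) ->
  (multilin_norm L <= multilin_norm M + multilin_norm N)%E.
Proof.
move=> LMN; apply: ge_ereal_sup => _ [vs vs1 <-]; rewrite LMN.
rewrite (@le_trans _ _ (`|M vs|%:E + `|N vs|%:E)%E) ?lee_fin ?ler_normD//.
by apply: leeD; apply: ereal_sup_ubound; exists vs.
Qed.

Lemma deriv_dist_refl K (c : @chart R n X) k h : (deriv_dist K c k h h <= 0)%E.
Proof.
apply: ge_ereal_sup => _ [a _ <-]; apply: multilin_norm_le0 => vs.
by rewrite subrr.
Qed.

Lemma deriv_dist_triangle K (c : @chart R n X) k g h f :
  (deriv_dist K c k g f <= deriv_dist K c k g h + deriv_dist K c k h f)%E.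
Proof.
apply: ge_ereal_sup => _ [a Ka <-].
apply: (@le_trans _ _ _ _ _ (multilin_norm_triangle _)); last first.
  by apply: leeD; apply: ereal_sup_ubound; exists a.
by move=> vs /=; rewrite subrKA.
Qed.

Lemma uniform_slack (d : nat -> \bar R) (e : R) (r : nat) : 0 < e ->
  (forall k, (k <= r)%N -> (d k < e%:E)%E) ->
  exists2 e', 0 < e' & forall k, (k <= r)%N -> (d k + e'%:E <= e%:E)%E.
Proof.
move=> e0; have one (x : \bar R) : (x < e%:E)%E ->
      exists2 e' : R, 0 < e' & (x + e'%:E <= e%:E)%E.
  case: x => [x| |]; rewrite ?lte_fin //= => xe.
  - exists (e - x); first by rewrite subr_gt0.
    by rewrite -EFinD lee_fin addrC subrK.
  - by exists 1; rewrite // addNye leNye.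
elim: r => [|r IH] dr.
  have [e' e'0 H] := one _ (dr 0%N (leqnn _)).
  by exists e' => // k; rewrite leqn0 => /eqP ->.
have [|e1 e10 H1] := IH; first by move=> k kr; apply: dr; rewrite leqW.
have [e2 e20 H2] := one _ (dr r.+1 (leqnn _)).
exists (Num.min e1 e2); first by rewrite lt_min e10.
move=> k; rewrite leq_eqVlt => /orP[/eqP ->|kr].
  by apply: le_trans H2; apply: leeD => //; rewrite lee_fin ge_min lexx orbT.
by apply: le_trans (H1 k kr); apply: leeD => //; rewrite lee_fin ge_min lexx.
Qed.

Lemma vs_basic_cover : \bigcup_(B in vs_basic) id B = setT.
Proof.
apply/seteqP; split => // f _; exists setT => //.
exists f, void, (fun=> set0), (of_void _), (fun=> 0%N), (fun=> 1); split.
- move=> x; exists setT; first exact: filterT.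
  by rewrite (_ : [set _ | _] = set0) //; apply/seteqP; split => -[].
- by case.
- by apply/seteqP; split => // g _ [].
Qed.

Lemma vs_basic_join (B B' : set (Cinfty A)) (h : Cinfty A) :
  vs_basic B -> vs_basic B' -> id B h -> id B' h ->
  exists C, [/\ vs_basic C, id C h & id C `<=` id B `&` id B'].
Proof.
have slack f (I : Type) (K : I -> set X) (c : I -> @chart R n X) r (e : I -> R) :
    (forall i, 0 < e i) ->
    (forall i k, (k <= r i)%N -> (deriv_dist (K i) (c i) k h f < (e i)%:E)%E) ->
    exists e' : I -> R, forall i, 0 < e' i /\ forall k, (k <= r i)%N ->
      forall g, (deriv_dist (K i) (c i) k g h < (e' i)%:E)%E ->
        (deriv_dist (K i) (c i) k g f < (e i)%:E)%E.
  move=> e0 hf; suff /boolp.choice[e' He'] : forall i, exists e' : R, (0 < e' /\ forall k, (k <= r i)%N ->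
      forall g, (deriv_dist (K i) (c i) k g h < e'%:E)%E ->
        (deriv_dist (K i) (c i) k g f < (e i)%:E)%E).
    by exists e'.
  move=> i.
  have [e' e'0 H] := uniform_slack (e0 i) (hf i).
  exists e'; split=> // k kr g gh.
  apply: le_lt_trans (deriv_dist_triangle _ _ _ _ h _) _.
  have := H k kr; have := hf i k kr.
  case: (deriv_dist _ _ k h f) => [x|//|] _; last by rewrite addeNy ltNyr.
  by apply: lt_le_trans; rewrite addeC lteD2lE.
move=> [f [I [K [c [r [e [lf pr ->]]]]]]] [f' [I' [K' [c' [r' [e' [lf' pr' ->]]]]]]].
move=> /= Bh B'h.
have [|d dP] := slack _ _ _ _ _ _ _ Bh; first by move=> i; case: (pr i).
have [|d' d'P] := slack _ _ _ _ _ _ _ B'h; first by move=> i; case: (pr' i).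
pose S T (u : I -> T) (u' : I' -> T) (s : I + I') :=
  match s with inl i => u i | inr i => u' i end.
eexists; split.
- exists h, (I + I')%type, (S _ K K'), (S _ c c'), (S _ r r'), (S _ d d').
  split; last reflexivity.
  + move=> x; have [U xU fU] := lf x; have [U' xU' fU'] := lf' x.
    exists (U `&` U'); first exact: filterI.
    apply: (@sub_finite_set _ _ ((inl @` [set i | K i `&` U !=set0]) `|`
                                 (inr @` [set i | K' i `&` U' !=set0]))).
      by move=> [i|i] [y [/= Ky [Uy U'y]]]; [left|right]; exists i => //; exists y.
    by rewrite finite_setU; split; exact: finite_image.
  + by case=> i /=; [have [? ? ? _] := pr i; have [] := dP i|
                     have [? ? ? _] := pr' i; have [] := d'P i].
- move=> i k _; apply: le_lt_trans (deriv_dist_refl _ _ _ _) _.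
  by rewrite lte_fin; case: i => i /=; [case: (dP i)|case: (d'P i)].
- move=> g gC; split=> i k kr.
  + by have [_] := dP i; apply => //; exact: gC (inl i) k kr.
  + by have [_] := d'P i; apply => //; exact: gC (inr i) k kr.
Qed.

Definition very_strong := Cinfty A.
HB.instance Definition _ := gen_eqMixin very_strong.
HB.instance Definition _ := gen_choiceMixin very_strong.
HB.instance Definition _ := @isBaseTopological.Build very_strong
  (set (Cinfty A)) vs_basic id vs_basic_cover vs_basic_join.

Definition differ_in_compact (f : Cinfty A) : set (Cinfty A) :=
  [set h | exists2 K : set X, compact K & [set x | h x <> f x] `<=` K].

(* Same carrier as very_strong, so that each topology has its own type. *)
Definition fine_very_strong := Cinfty A.
HB.instance Definition _ := gen_eqMixin fine_very_strong.
HB.instance Definition _ := gen_choiceMixin fine_very_strong.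
HB.instance Definition _ := @isSubBaseTopological.Build fine_very_strong
  (set (Cinfty A))
  [set B | open (B : set very_strong) \/ exists f, B = differ_in_compact f] id.

End fine_very_strong_topology.

Section R_times_S2.
Context {R : realType}.

Definition sqnorm n (v : 'rV[R]_n) : R := \sum_i v 0 i ^+ 2.

Definition sphere2 : set 'rV[R]_3 := [set z | sqnorm z = 1].

Definition RxS2 : topologicalType := (R * set_type sphere2)%type.

(* Stereographic projection of the sphere from the pole (0, 0, (-1)^b), and the
   chart (t, z) |-> (t, stereo b z) of the product manifold. *)
Definition stereo (b : bool) (z : set_type sphere2) : 'rV[R]_2 :=
  (1 - (-1) ^+ b * val z 0 ord_max)^-1 *: lsubmx (val z : 'rV[R]_(2 + 1)).

Definition stereo_inv_fun (b : bool) (y : 'rV[R]_2) : 'rV[R]_(2 + 1) :=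
  (1 + sqnorm y)^-1 *: row_mx (2 *: y) ((-1) ^+ b * (sqnorm y - 1))%:M.

Lemma sqnorm_ge0 n (v : 'rV[R]_n) : 0 <= sqnorm v.
Proof. by apply: sumr_ge0 => i _; exact: sqr_ge0. Qed.

Lemma sqnorm1_gt0 n (v : 'rV[R]_n) : 0 < 1 + sqnorm v.
Proof. by rewrite ltr_pwDl ?sqnorm_ge0. Qed.

Lemma sqnormZ n a (v : 'rV[R]_n) : sqnorm (a *: v) = a ^+ 2 * sqnorm v.
Proof.
by rewrite /sqnorm big_distrr; apply: eq_bigr => i _; rewrite mxE exprMn.
Qed.

Lemma sqnorm_split (z : 'rV[R]_(2 + 1)) :
  sqnorm z = sqnorm (lsubmx z) + z 0 ord_max ^+ 2.
Proof.
rewrite /sqnorm big_split_ord /=; congr (_ + _).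
  by apply: eq_bigr => i _; rewrite mxE.
by rewrite big_ord1; congr (z 0 _ ^+ 2); exact: val_inj.
Qed.

Lemma row_split (z z' : 'rV[R]_(2 + 1)) :
  lsubmx z = lsubmx z' -> z 0 ord_max = z' 0 ord_max -> z = z'.
Proof.
move=> lz rz; rewrite -[z]hsubmxK -[z']hsubmxK lz; congr row_mx.
apply/rowP => j; rewrite !mxE (_ : rshift 2 j = ord_max) //.
by apply: val_inj; rewrite /= ord1.
Qed.

Lemma stereo_coord b z i : stereo b z 0 i =
  (1 - (-1) ^+ b * val z 0 ord_max)^-1 * val z 0 (lshift 1 i).
Proof. by rewrite mxE; congr (_ * _); exact: mxE. Qed.

Lemma lsubmx_stereo_inv b y :
  lsubmx (stereo_inv_fun b y) = (2 / (1 + sqnorm y)) *: y.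
Proof.
by rewrite /stereo_inv_fun linearZ /= row_mxKl scalerA mulrC.
Qed.

Lemma last_stereo_inv b y : stereo_inv_fun b y 0 ord_max =
  (-1) ^+ b * (sqnorm y - 1) / (1 + sqnorm y).
Proof.
rewrite mxE (_ : ord_max = rshift 2 (0 : 'I_1)); last exact: val_inj.
by rewrite row_mxEr mxE eqxx mulr1n mulrC.
Qed.

Lemma stereo_inv_subproof (b : bool) (y : 'rV[R]_2) :
  stereo_inv_fun b y \in sphere2.
Proof.
rewrite inE /sphere2 /= sqnorm_split lsubmx_stereo_inv last_stereo_inv sqnormZ.
have := sqnorm1_gt0 y; set q := sqnorm y => q0.
rewrite !exprMn sqrr_sign; field; exact: lt0r_neq0.
Qed.

Definition stereo_inv (b : bool) (y : 'rV[R]_2) : set_type sphere2 :=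
  exist _ (stereo_inv_fun b y) (stereo_inv_subproof b y).

Definition cyl_map (b : bool) (x : RxS2) : 'rV[R]_(1 + 2) :=
  row_mx x.1%:M (stereo b x.2).

Definition cyl_inv (b : bool) (w : 'rV[R]_(1 + 2)) : RxS2 :=
  (lsubmx w 0 0, stereo_inv b (rsubmx w)).

Definition cyl_dom (b : bool) : set RxS2 :=
  [set x : RxS2 | (-1) ^+ b * val x.2 0 ord_max != 1].

Lemma cyl_invK b w : cyl_dom b (cyl_inv b w) /\ cyl_map b (cyl_inv b w) = w.
Proof.
have := sqnorm1_gt0 (rsubmx w : 'rV[R]_2); set q := sqnorm _ => q0.
have q0' := lt0r_neq0 q0.
have den : 1 - (-1) ^+ b * stereo_inv_fun b (rsubmx w) 0 ord_max = 2 / (1 + q).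
  rewrite last_stereo_inv -/q !mulrA -expr2 sqrr_sign mul1r.
  by field.
split.
  by rewrite /cyl_dom /= eq_sym -subr_eq0 den mulf_neq0 ?invr_eq0 ?pnatr_eq0.
rewrite /cyl_map /stereo /= den lsubmx_stereo_inv -/q scalerA.
rewrite (_ : _ * _ = 1); last by field; rewrite q0'.
rewrite scale1r -[RHS]hsubmxK; congr row_mx.
by apply/rowP => j; rewrite ord1 !mxE eqxx mulr1n; congr (w 0 _); exact: val_inj.
Qed.

Lemma cyl_cod b : cyl_map b @` cyl_dom b = setT.
Proof.
by apply/seteqP; split=> // w _; have [? <-] := cyl_invK b w; exists (cyl_inv b w).
Qed.

Lemma cyl_mapK b x : cyl_dom b x -> cyl_inv b (cyl_map b x) = x.
Proof.
case: x => t z; rewrite /cyl_dom /= => dz.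
rewrite /cyl_inv /cyl_map /= row_mxKl row_mxKr mxE eqxx mulr1n; congr (_, _).
have : sqnorm (val z) = 1 by have /set_mem := valP z.
rewrite (sqnorm_split (val z)) => /(canRL (addrK _)) sa.
set u := (-1) ^+ b * _ in dz; have u1 : 1 - u != 0 by rewrite subr_eq0 eq_sym.
have u2 : u ^+ 2 = val z 0 ord_max ^+ 2 by rewrite exprMn sqrr_sign mul1r.
have qE : sqnorm (stereo b z) = 2 / (1 - u) - 1.
  by rewrite /stereo -/u sqnormZ sa -u2; field.
apply: val_inj => /=; apply: row_split.
  rewrite lsubmx_stereo_inv qE /stereo -/u scalerA.
  rewrite [1 + (_ - 1)]addrC subrK (_ : _ * _ = 1) ?scale1r //; field.
  exact: u1.
rewrite last_stereo_inv qE [1 + (_ - 1)]addrC subrK.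
have -> : (-1) ^+ b * (2 / (1 - u) - 1 - 1) / (2 / (1 - u)) = (-1) ^+ b * u.
  by move: ((-1) ^+ b) => s; field; exact: u1.
by rewrite mulrA -expr2 sqrr_sign mul1r.
Qed.

Lemma coord_x2_continuous j : continuous (fun x : RxS2 => val x.2 0 j : R).
Proof.
move=> x; apply: (@continuous_comp _ _ _ (fun x : RxS2 => val x.2)
  (fun z : 'rV[R]_3 => z 0 j)); last exact: coord_continuous.
apply: (@continuous_comp _ _ _ snd (fun z : set_type sphere2 => val z)).
  exact: cvg_snd.
exact: initial_continuous.
Qed.

Lemma cyl_dom_open b : open (cyl_dom b).
Proof.
rewrite (_ : cyl_dom b =
  (fun x : RxS2 => (-1) ^+ b * val x.2 0 ord_max) @^-1` [set r | r != 1]) //.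
apply: open_comp; last exact: open_neq.
by move=> x _; apply: cvgMl_tmp; exact: coord_x2_continuous.
Qed.

Lemma cyl_cod_open b : open (cyl_map b @` cyl_dom b).
Proof. by rewrite cyl_cod; exact: openT. Qed.

Lemma row_continuous (T : topologicalType) n (f : T -> 'rV[R]_n) (x : T) :
  (forall j, {for x, continuous (fun y => f y 0 j)}) -> {for x, continuous f}.
Proof.
move=> cf U [P Pf PU]; rewrite /= nbhs_simpl.
have : \forall y \near x, forall j, P 0 j (f y 0 j).
  by apply: filter_forall => j; exact: cf (Pf 0 j).
by apply: filterS => y Py; apply: PU => i j; rewrite ord1.
Qed.

Lemma cyl_map_continuous b : {within cyl_dom b, continuous (cyl_map b)}.
Proof.
apply: continuous_in_subspaceT => x /set_mem xd.
apply: row_continuous => j; rewrite /prop_for /continuous_at /cyl_map.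
have [i ->|i ->] := split_ordP j.
  under eq_fun do rewrite row_mxEl mxE ord1 eqxx mulr1n.
  by rewrite row_mxEl mxE ord1 eqxx mulr1n; exact: cvg_fst.
under eq_fun do rewrite row_mxEr stereo_coord.
rewrite row_mxEr stereo_coord.
apply: cvgM; last exact: coord_x2_continuous.
apply: cvgV; first by rewrite subr_eq0 eq_sym.
apply: cvgB; first exact: cvg_cst.
by apply: cvgMl_tmp; exact: coord_x2_continuous.
Qed.

Lemma Ck_sqnorm (V : normedModType R) n k (D : set V) (f : V -> 'rV[R]_n) :
  open D -> Ck k D f -> Ck k D (fun x => sqnorm (f x)).
Proof.
move=> oD cf; apply: Ck_sum => // i; rewrite /=.
under eq_fun do rewrite expr2.
by apply: CkM => //; exact: Ck_coord.
Qed.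

Lemma Ck_rsubmx k (D : set 'rV[R]_(1 + 2)) :
  open D -> Ck k D (fun w : 'rV[R]_(1 + 2) => rsubmx w).
Proof.
move=> oD; apply: Ck_mx => // j; under eq_fun do rewrite mxE.
by apply: Ck_coord => //; exact: Ck_id.
Qed.

Lemma Ck_stereo_inv b k (D : set 'rV[R]_(1 + 2)) : open D ->
  Ck k D (fun w : 'rV[R]_(1 + 2) => stereo_inv_fun b (rsubmx w)).
Proof.
move=> oD; have cr := Ck_rsubmx k oD; have cq := Ck_sqnorm oD cr.
apply: Ck_mx => // j; under eq_fun do rewrite mxE.
apply: CkM => //.
  apply: CkV => //; first by move=> x _; exact/lt0r_neq0/sqnorm1_gt0.
  by apply: CkD => //; exact: Ck_cst.
have [i ->|i ->] := split_ordP j.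
  under eq_fun do rewrite row_mxEl mxE.
  by apply: CkM => //; [exact: Ck_cst|exact: Ck_coord].
rewrite (ord1 i); under eq_fun do rewrite row_mxEr mxE eqxx mulr1n.
apply: CkM => //; first exact: Ck_cst.
by apply: CkD => //; exact: Ck_cst.
Qed.

Lemma cyl_inv_cont b : continuous (cyl_inv b).
Proof.
have c1 : continuous (fun w : 'rV[R]_(1 + 2) => lsubmx w 0 0).
  by under eq_fun do rewrite mxE; exact: coord_continuous.
suff c2 : continuous (fun w : 'rV[R]_(1 + 2) => stereo_inv b (rsubmx w)).
  by move=> w; exact: cvg_pair (c1 w) (c2 w).
apply: (@continuous_comp_initial _ _ _ (set_val : set_type sphere2 -> 'rV[R]_3)).
move=> {}w; apply: differentiable_continuous.
by apply: (@Ck_diff _ _ _ 0 setT) => //; exact: Ck_stereo_inv openT.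
Qed.

Lemma cyl_inv_continuous b :
  {within cyl_map b @` cyl_dom b, continuous (cyl_inv b)}.
Proof. exact/continuous_subspaceT/cyl_inv_cont. Qed.

Definition cyl_chart (b : bool) : chart 3 RxS2 :=
  @Chart R 3 RxS2 (cyl_dom b) (cyl_map b) (cyl_inv b) (@cyl_dom_open b)
    (@cyl_cod_open b) (@cyl_mapK b) (@cyl_map_continuous b)
    (@cyl_inv_continuous b).

Lemma cyl_cover : \bigcup_(c in range cyl_chart) chart_dom c = setT.
Proof.
apply/seteqP; split=> // x _.
have [x1|x1] := eqVneq (val x.2 0 ord_max) 1.
  exists (cyl_chart true); first by exists true.
  by rewrite /= /cyl_dom /= x1 mulr1 expr1 lt_eqF // (lt_trans (ltrN10 _)).
by exists (cyl_chart false); [exists false|rewrite /= /cyl_dom /= expr0 mul1r].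
Qed.

Lemma cyl_compat (c d : chart 3 RxS2) :
  range cyl_chart c -> range cyl_chart d -> smooth_transition c d.
Proof.
move=> [b _ <-] [b' _ <-]; rewrite /smooth_transition /=.
have -> : cyl_map b @` (cyl_dom b `&` cyl_dom b') = cyl_inv b @^-1` cyl_dom b'.
  apply/seteqP; split=> [_ [x [xb xb'] <-]|w /= wb'] /=; first by rewrite cyl_mapK.
  by have [wb wE] := cyl_invK b w; exists (cyl_inv b w).
set D := _ @^-1` _; have oD : open D.
  by apply: open_comp; [move=> w _; exact: cyl_inv_cont|exact: cyl_dom_open].
apply/smooth_onP => k; have cs := Ck_stereo_inv b k oD.
apply: (@Ck_mx _ _ (1 + 2)) => // j; rewrite /comp /cyl_map.
have [i ->|i ->] := split_ordP j.
  rewrite (ord1 i); under eq_fun do rewrite row_mxEl mxE eqxx mulr1n /= mxE.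
  by apply: Ck_coord => //; exact: Ck_id.
under eq_fun do rewrite row_mxEr stereo_coord.
apply: CkM => //; last exact: (Ck_coord (lshift 1 i) oD cs).
apply: CkV => //; first by move=> w Dw; rewrite subr_eq0 eq_sym.
under eq_fun do rewrite -mulNr.
apply: CkD => //; first exact: Ck_cst.
by apply: CkM => //; [exact: Ck_cst|exact: (Ck_coord ord_max oD cs)].
Qed.

Definition RxS2_atlas : smooth_atlas 3 RxS2 := SmoothAtlas cyl_cover cyl_compat.

End R_times_S2.

Section unit_of_N.
Context {R : realType}.

Lemma chart_overlap_open n (X : topologicalType) (c d : @chart R n X) :
  open (c @` (chart_dom c `&` chart_dom d)).
Proof.
have := @chart_inv_continuous _ _ _ c.
rewrite continuous_open_subspace => [ci|]; last exact: chart_cod_open.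
rewrite openE => _ [x [xc xd] <-]; rewrite /interior.
have cx : (chart_map c @` chart_dom c) (c x) by exists x.
have H1 : \forall w \near c x, (chart_map c @` chart_dom c) w.
  by apply: open_nbhs_nbhs; split => //; exact: chart_cod_open.
have H2 : \forall w \near c x, chart_dom d (chart_inv c w).
  apply: (ci (c x) (mem_set cx)); rewrite chart_mapK //.
  by apply: open_nbhs_nbhs; split => //; exact: chart_dom_open.
apply: filterS2 H1 H2 => _ [y yc <-]; rewrite chart_mapK // => yd.
by exists y.
Qed.

Lemma unit_smooth : smooth_function (@RxS2_atlas R) fst.
Proof.
move=> c cA vs _ [x xc <-].
have [d /= [b _ bd] xd] : (\bigcup_(d in atlas_charts (@RxS2_atlas R)) chart_dom d) x.
  by rewrite atlas_cover.
have [sc _] := cA d (ex_intro2 _ _ b I bd).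
have := smooth_on_coord (lshift 2 (0 : 'I_1)) (@chart_overlap_open _ _ c d) sc.
move=> /(_ vs (c x)); rewrite (_ : (fun y => _) = fst \o chart_inv c).
  by apply; exists x.
apply/funext => w; rewrite -bd /= /cyl_map row_mxEl mxE eqxx mulr1n //.
Qed.

End unit_of_N.

Section the_group_N.
Context (R : realType).

Local Notation FVS := (fine_very_strong (@RxS2_atlas R)).

Definition Diff_plus : set (R -> R) :=
  [set f : R -> R | [/\ smooth_on setT f,
      exists g : R -> R, [/\ smooth_on setT g, cancel f g & cancel g f]
    & forall t, 0 < (f^`()%classic) t] ].

Definition groupN : set FVS :=
  [set F : FVS | forall z : set_type sphere2, Diff_plus (fun t => F (t, z))].

Definition groupNc : set FVS :=
  [set F : FVS | groupN F /\ exists2 K : set RxS2, compact K &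
     forall t z, ~ K (t, z) -> F (t, z) = t].

Definition unitN : FVS := MkCinfty unit_smooth.

End the_group_N.

(* Main.v *)
Require Import Defs.
From mathcomp Require Import all_boot all_order all_algebra.
From mathcomp Require Import all_classical all_reals all_analysis.
From mathcomp Require Import ring lra.
(* Last, so that iterD is the iterated derivative and not the lemma on iter. *)
Import Defs.

(** The component is squeezed between two facts.

    It is contained in N_c because in the fine very strong topology the set of
    functions that differ from a given one only in a compact set is not just
    open but clopen: these sets are the classes of an equivalence relation, so
    the complement of one is a union of others (differ_in_compact_clopen).  A
    connected set through the unit p therefore stays among the functions that
    agree with p off a compact set.

    It contains N_c because every F in N_c is joined to p by the segment
    p + s (F - p), s in [0, 1], which stays in N and is continuous in s.

    It stays in N since, for fixed z, each p + s (F - p) has positive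
    derivative, is onto by the intermediate value theorem, and its inverse is
    smooth by the bootstrap h^-1' = 1 / (h' o h^-1) (Diff_plus_segment,
    smooth_inverse).

    Continuity holds on any Hausdorff manifold, for two functions f and g that
    agree off a compact set K (segment_continuous).  A basic neighbourhood
    prescribes infinitely many estimates, indexed by a locally finite family of
    compact sets, but at points off K the segment does not move at all, and near
    each point of K only finitely many estimates matter.  Each of these is a
    bound on (t - s) times derivatives of g - f over a compact set, and these
    derivatives are bounded there, uniformly over unit directions
    (iterD_bounded). *)

Set Implicit Arguments.
Unset Strict Implicit.
Unset Printing Implicit Defensive.

Import Order.TTheory GRing.Theory Num.Theory.
Import numFieldNormedType.Exports.

Local Open Scope classical_set_scope.
Local Open Scope ring_scope.

(** * Iterated directional derivatives *)

Section iterated_derivatives.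
Context {R : realType}.

Lemma iterD_eq (V W : normedModType R) (D : set V) (f g : V -> W) vs x :
  open D -> (forall y, D y -> f y = g y) -> D x -> iterD vs f x = iterD vs g x.
Proof.
move=> oD fg; elim: vs x => [|v vs IH] x Dx /=; first exact: fg.
by apply: near_eq_derive; apply: open_near Dx _.
Qed.

Lemma iterDD (V W : normedModType R) (D : set V) (f g : V -> W) vs x :
  open D -> smooth_on D f -> smooth_on D g -> D x ->
  iterD vs (fun y => f y + g y) x = iterD vs f x + iterD vs g x.
Proof.
move=> oD sf sg; elim: vs x => [//|v vs IH] x Dx /=.
rewrite (@near_eq_derive _ _ _ _ (iterD vs f + iterD vs g)); last first.
  exact: (open_near oD Dx IH).
by rewrite deriveD //; apply: diff_derivable; [exact: sf|exact: sg].
Qed.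

Lemma iterDZ (V W : normedModType R) (D : set V) (a : R) (f : V -> W) vs x :
  open D -> smooth_on D f -> D x ->
  iterD vs (fun y => a *: f y) x = a *: iterD vs f x.
Proof.
move=> oD sf; elim: vs x => [//|v vs IH] x Dx /=.
rewrite (@near_eq_derive _ _ _ _ (a \*: iterD vs f)); last first.
  exact: (open_near oD Dx IH).
by rewrite deriveZ //; apply: diff_derivable; exact: sf.
Qed.

Lemma smooth_onZ (V W : normedModType R) (D : set V) (a : R) (f : V -> W) :
  open D -> smooth_on D f -> smooth_on D (fun x => a *: f x).
Proof.
move=> oD sf vs x Dx; apply: (@near_eq_differentiable _ _ _ (a \*: iterD vs f)).
  by apply: (open_near oD Dx) => y Dy; rewrite (iterDZ a vs oD).
by apply: differentiableZ; exact: sf.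
Qed.

Lemma iterD_cst0 (V W : normedModType R) vs (x : V) :
  iterD vs (fun=> 0 : W) x = 0.
Proof.
elim: vs x => [//|v vs IH] x /=.
by rewrite (_ : iterD vs _ = cst 0) ?derive_cst //; apply/funext.
Qed.

Lemma smooth_on_derive (V W : normedModType R) (D : set V) (f : V -> W) v :
  smooth_on D f -> smooth_on D (fun x => 'D_v f x).
Proof. by move=> sf vs x Dx; rewrite -iterD_rcons; exact: sf. Qed.

Lemma smooth_on_lin (V : normedModType R) (D : set V) (a : R) (f g : V -> R) :
  open D -> smooth_on D f -> smooth_on D g ->
  smooth_on D (fun x => f x + a * g x).
Proof.
move=> oD /smooth_onP cf /smooth_onP cg; apply/smooth_onP => k.
by apply: CkD => //; apply: CkM => //; exact: Ck_cst.
Qed.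

Lemma iterD_sumZ (V W : normedModType R) (D : set V) m (a : 'I_m -> R)
    (f : 'I_m -> V -> W) vs x :
  open D -> (forall j, smooth_on D (f j)) -> D x ->
  iterD vs (fun y => \sum_j a j *: f j y) x = \sum_j a j *: iterD vs (f j) x.
Proof.
move=> oD sf Dx; elim: m a f sf => [|m IH] a f sf.
  rewrite big_ord0 -[RHS](iterD_cst0 W vs x); congr iterD.
  by apply/funext => y; rewrite big_ord0.
rewrite big_ord_recr /= -(IH (fun j => a (widen_ord (leqnSn m) j))
  (fun j => f (widen_ord (leqnSn m) j))); last by move=> j; exact: sf.
rewrite -(iterDZ (a ord_max) vs oD (sf ord_max) Dx) -(@iterDD _ _ D) //.
- by congr iterD; apply/funext => y; rewrite big_ord_recr.
- apply/smooth_onP => k; apply: Ck_sum => // j.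
  by move: k; apply/smooth_onP; exact: smooth_onZ.
- exact: smooth_onZ.
Qed.

Lemma derive_row_sum (n : nat) (W : normedModType R) (f : 'rV[R]_n -> W) v x :
  differentiable f x -> 'D_v f x = \sum_j v 0 j *: 'D_(delta_mx 0 j) f x.
Proof.
move=> df; rewrite {1}(row_sum_delta v) deriveE // linear_sum.
by apply: eq_bigr => j _; rewrite linearZ /= -deriveE.
Qed.

(** The directions range over an infinite set, so boundedness on compact sets is
    not just continuity of each iterD vs f.  By linearity in the innermost
    direction v, D_v f is a combination of the finitely many D_(e_j) f with
    coefficients at most |v|, to which induction applies. *)
Lemma iterD_bounded (n : nat) (W : normedModType R) (D C : set 'rV[R]_n) k
    (f : 'rV[R]_n -> W) :
  open D -> smooth_on D f -> compact C -> C `<=` D ->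
  exists M, forall x (vs : seq 'rV[R]_n), C x -> size vs = k ->
    (forall v, v \in vs -> `|v| <= 1) -> `|iterD vs f x| <= M.
Proof.
move=> oD + cC CD; elim: k f => [|k IH] f sf.
  have /compact_bounded[M [_ /(_ (M + 1) _)]] : compact (f @` C).
    apply: continuous_compact cC.
    apply: continuous_in_subspaceT => x /set_mem Cx.
    by apply: differentiable_continuous; exact: (sf [::] x (CD _ Cx)).
  rewrite ltrDl => /(_ ltr01) bM; exists (M + 1) => x vs Cx /size0nil -> _ /=.
  by apply: bM; exists x.
have /boolp.choice[M MP] : forall j : 'I_n, exists M,
    forall x (vs : seq 'rV[R]_n), C x -> size vs = k ->
    (forall v, v \in vs -> `|v| <= 1) ->
    `|iterD vs (fun y => 'D_(delta_mx 0 j) f y) x| <= M.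
  by move=> j; apply: IH; exact: smooth_on_derive.
exists (\sum_j M j) => x vs Cx; elim/last_ind: vs => [//|vs v _].
rewrite size_rcons => -[sk] vs1; rewrite iterD_rcons.
rewrite (@iterD_eq _ _ D _ (fun y => \sum_j v 0 j *: 'D_(delta_mx 0 j) f y)) //.
- rewrite (@iterD_sumZ _ _ D) //;
    [|by move=> j; exact: smooth_on_derive|exact: CD].
  apply: le_trans (ler_norm_sum _ _ _) _; apply: ler_sum => j _.
  rewrite normrZ -[M j]mul1r; apply: ler_pM => //.
    have := vs1 v; rewrite mem_rcons mem_head => /(_ isT); apply: le_trans.
    (* The norm of a row vector is the maximum of its entries. *)
    rewrite [leRHS]/Num.Def.normr /= mx_normrE.
    exact: (le_bigmax _ (fun ij => `|v ij.1 ij.2|) (ord0, j)).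
  by apply: MP => // u uvs; apply: vs1; rewrite mem_rcons inE uvs orbT.
- by move=> y Dy; apply: derive_row_sum; exact: (sf [::]).
- exact: CD.
Qed.

End iterated_derivatives.

(** * Diffeomorphisms of the line *)

Section diffeomorphisms.
Context {R : realType}.

Lemma Ck_comp (V : normedModType R) k (D : set V) (f : R -> R) (g : V -> R) :
  open D -> Ck k setT f -> Ck k D g -> Ck k D (fun x => f (g x)).
Proof.
move=> oD; elim: k f g => [|k IH] f g cf cg.
  by split=> // x Dx; apply: differentiable_comp (Ck_diff cg Dx) (Ck_diff cf I).
split=> [x Dx|v].
  exact: differentiable_comp (Ck_diff cg Dx) (Ck_diff cf I).
have [_ kf] := cf; have [_ kg] := cg.
apply: Ck_eq (CkM oD (IH _ _ (kf 1) (CkS cg)) (kg v)) => // x Dx.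
have dg := Ck_diff cg Dx; have df : differentiable f (g x) := Ck_diff cf I.
rewrite [RHS]deriveE; last exact: differentiable_comp.
rewrite (diff_comp dg df) /= (diff1E df) derive1E [in LHS](deriveE v dg).
by rewrite mulrC.
Qed.

(** The inverse is differentiable with g' = 1 / (f' o g), and this formula for
    g' has as many derivatives as g, so the order of differentiability of g
    increases by induction. *)
Lemma smooth_inverse (f g : R -> R) : cancel f g -> cancel g f ->
  smooth_on setT f -> (forall t, f^`()%classic t != 0) -> smooth_on setT g.
Proof.
move=> fK gK sf f0.
have df (t : R) : differentiable f t by exact: (sf [::] t I).
have dg (y : R) : is_derive y 1 g (f^`()%classic (g y))^-1.
  rewrite -{1}(gK y); apply: (@is_derive_inverse R) (f0 _).
  - by near=> t; exact: fK.
  - by near=> t; apply: differentiable_continuous; exact: df.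
  - by rewrite derive1E; apply: derivableP; exact: diff_derivable.
have dfg (y : R) : differentiable g y.
  by apply/derivable1_diffP; exact: ex_derive.
have /smooth_onP cf' : smooth_on setT (f^`()%classic).
  by rewrite (_ : f^`()%classic = 'D_1 f); [exact: smooth_on_derive|
     apply/funext => t; rewrite derive1E].
apply/smooth_onP; elim=> [|k IH]; split=> // v.
have := CkM openT (CkV openT _ (Ck_comp openT (cf' k) IH)) (Ck_cst k setT v).
move=> /(_ (fun t _ => f0 (g t))); apply: Ck_eq; first exact: openT.
move=> y _; rewrite deriveE // diff1E //= (derive1E g).
rewrite (@derive_val _ _ _ _ _ _ _ (dg y)).
exact: mulrC.
Unshelve. all: by end_near. Qed.

(** Surjectivity of h := t + s (f t - t): since f (g y) = y and f is increasing,
    g y <= y if and only if y <= f y, so the values of h at y and at g y enclose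
    y, whatever s in [0, 1] is. *)
Lemma Diff_plus_segment (f : R -> R) (s : R) : 0 <= s <= 1 ->
  Diff_plus f -> Diff_plus (fun t => t + s * (f t - t)).
Proof.
move=> /andP[s0 s1] [sf [g [sg fK gK]] f'0]; set h := (fun t : R => _).
have df (t : R) : differentiable f t by exact: (sf [::] t I).
have sh : smooth_on setT h.
  have si : smooth_on setT (fun t : R => t).
    by apply/smooth_onP => k; exact: Ck_id.
  have := smooth_on_lin s openT si (smooth_on_lin (-1) openT sf si).
  apply: smooth_on_eq; first exact: openT.
  by move=> t _; rewrite mulN1r.
have dh (t : R) : differentiable h t by exact: (sh [::] t I).
have h'E t : h^`()%classic t = 1 - s + s * f^`()%classic t.
  have df1 : derivable f t 1 by exact: diff_derivable.
  rewrite !derive1E (_ : h = id + s \*: (f - id)) //.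
  rewrite deriveD //; last by apply: derivableZ; exact: derivableB.
  rewrite deriveZ; last exact: derivableB.
  by rewrite deriveB // derive_id /GRing.scale /=; ring.
have h'0 t : 0 < h^`()%classic t.
  rewrite h'E; have := f'0 t; move: s0; rewrite le_eqVlt => /predU1P[<-|s0] f't.
    by rewrite mul0r subr0 addr0.
  by rewrite ltr_wpDl ?subr_ge0 // mulr_gt0.
have mono (u : R -> R) : (forall t, differentiable u t) ->
    (forall t, 0 < u^`()%classic t) -> {homo u : x y / x < y}.
  move=> du u0 x y xy; apply: (@gtr0_derive1_lt_cc _ u x y) => //.
  - by move=> t _; exact: diff_derivable.
  - by apply: continuous_subspaceT => t; exact: differentiable_continuous.
  - by rewrite in_itv /= lexx ltW.
  - by rewrite in_itv /= lexx ltW.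
have hh := mono _ dh h'0; have hf := mono _ df f'0.
have hsurj y : exists t, h t = y.
  have cI (a b : R) : {within `[a, b], continuous h}.
    by apply: continuous_subspaceT => t; exact: differentiable_continuous.
  have fm := ltW_homo hf.
  have [yg|/ltW gy] := leP y (g y).
    have fy := fm _ _ yg; rewrite gK in fy.
    have [|t _ <-] := @IVT _ h y (g y) y yg (cI _ _); last by exists t.
    rewrite ge_min le_max /h gK.
    by apply/andP; split; apply/orP; [left|right]; nra.
  have fy := fm _ _ gy; rewrite gK in fy.
  have [|t _ <-] := @IVT _ h (g y) y y gy (cI _ _); last by exists t.
  rewrite ge_min le_max /h gK.
  by apply/andP; split; apply/orP; [left|right]; nra.
have [hi hiK] := boolp.choice hsurj.
have hK : cancel h hi by apply: inj_can_sym hiK _; exact: inc_inj (le_mono hh).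
split=> //; exists hi; split=> //.
by apply: (smooth_inverse hK hiK sh) => t; rewrite gt_eqF.
Qed.

End diffeomorphisms.

(** * General topology *)

Lemma near_finite_set (T I : Type) (F : set_system T) (S : set I)
    (P : I -> T -> Prop) : Filter F -> finite_set S ->
  (forall i, S i -> \forall t \near F, P i t) ->
  \forall t \near F, forall i, S i -> P i t.
Proof.
move=> FF /(@finite_seqP {classic I})[l ->] SP.
elim: l SP => [_|i l IH SP]; first exact: filterE.
have Pi := SP i (mem_head i l).
have Pl : \forall t \near F, forall j, [set` l] j -> P j t.
  by apply: IH => j jl; apply: SP; rewrite /= inE jl orbT.
apply: filterS2 Pi Pl => t it lt j /=.
by rewrite inE => /predU1P[->//|jl]; exact: lt.
Qed.

Lemma hausdorff_injective (X Y : topologicalType) (f : X -> Y) :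
  continuous f -> injective f -> hausdorff_space Y -> hausdorff_space X.
Proof.
move=> cf fI hY x y xy; apply: fI; apply: hY => U V fxU fyV.
by have [z [? ?]] := xy _ _ (cf x _ fxU) (cf y _ fyV); exists (f z).
Qed.

(** * Segments in the fine very strong topology *)

Section fine_very_strong_topology.
Context {R : realType} (n : nat) (X : topologicalType).
Context (A : @smooth_atlas R n X).

Lemma open_differ_in_compact (f : Cinfty A) :
  open (differ_in_compact f : set (fine_very_strong A)).
Proof.
exists [set differ_in_compact f]; last by rewrite bigcup_set1.
by move=> _ ->; apply: (@finI_from1 _ _ _ id); right; exists f.
Qed.

(** If h is outside the set of f, so is everything that differs from h only in a
    compact set, because differing in a compact set is transitive. *)
Lemma differ_in_compact_clopen (f : Cinfty A) :
  clopen (differ_in_compact f : set (fine_very_strong A)).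
Proof.
split; first exact: open_differ_in_compact.
rewrite -openC openE => h hf.
apply: filterS (open_nbhs_nbhs (conj (open_differ_in_compact h) _)).
  move=> g [K cK hgK] [L cL gL]; apply: hf.
  exists (K `|` L); first exact: compactU.
  move=> x hfx; apply: contrapT => /not_orP[Kx Lx]; apply: hfx.
  have -> : h x = g x by apply: contrapT => hg; apply: Kx; apply: hgK => /esym.
  by apply: contrapT => gf; apply: Lx; exact: gL.
by exists set0; [exact: compact0|move=> x /=].
Qed.

(** It suffices to test the two kinds of sets that generate the topology. *)
Lemma continuous_to_fine_very_strong (T : topologicalType)
    (u : T -> fine_very_strong A) :
  (forall t B, vs_basic B -> B (u t) -> \forall t' \near t, B (u t')) ->
  (forall t f, differ_in_compact f (u t) ->
    \forall t' \near t, differ_in_compact f (u t')) ->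
  continuous u.
Proof.
move=> uv ud; apply/continuousP => _ [D' D'sub <-].
rewrite preimage_bigcup; apply: bigcup_open => _ /D'sub [E Esub <-].
rewrite openE => t Et; apply: filter_bigI => B BE.
have Bt : B (u t) := Et _ BE.
have := Esub _ BE; rewrite inE => -[[D'' Dsub /seteqP[DB BD]]|[f Bf]].
  have [B0 D0 B0t] := BD _ Bt.
  by apply: filterS (uv _ _ (Dsub _ D0) B0t) => t' B0t'; apply: DB; exists B0.
by rewrite Bf in Bt *; exact: ud.
Qed.

Lemma chart_image_open (c : @chart R n X) (U : set X) :
  open U -> open (c @` (chart_dom c `&` U)).
Proof.
move=> oU; have := @chart_inv_continuous _ _ _ c.
rewrite continuous_open_subspace => [ci|]; last exact: chart_cod_open.
rewrite openE => _ [x [xc xU] <-]; rewrite /interior.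
have cx : (chart_map c @` chart_dom c) (c x) by exists x.
have H1 : \forall w \near c x, (chart_map c @` chart_dom c) w.
  by apply: open_nbhs_nbhs; split => //; exact: chart_cod_open.
have H2 : \forall w \near c x, U (chart_inv c w).
  apply: (ci (c x) (mem_set cx)); rewrite chart_mapK //.
  exact: open_nbhs_nbhs.
apply: filterS2 H1 H2 => _ [y yc <-]; rewrite chart_mapK // => yU.
by exists y.
Qed.

(** The image under the chart of the open set on which h vanishes is open, so
    iterated derivatives may be computed on it. *)
Lemma kderiv_eq0 (c : @chart R n X) (U : set X) (h : X -> R) k x vs : open U ->
  (forall y, U y -> h y = 0) -> chart_dom c x -> U x ->
  @kderiv _ _ _ k (h \o chart_inv c) (c x) vs = 0.
Proof.
move=> oU h0 cx Ux; rewrite /kderiv -(iterD_cst0 R vs (c x)).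
apply: (@iterD_eq _ _ _ (c @` (chart_dom c `&` U))).
- exact: chart_image_open.
- by move=> _ [y [cy Uy] <-] /=; rewrite chart_mapK // h0.
- by exists x.
Qed.

Lemma kderiv_bounded (c : @chart R n X) (C : set X) (h : X -> R) r :
  smooth_on (chart_cod c) (h \o chart_inv c) ->
  compact C -> C `<=` chart_dom c ->
  exists M, forall k x (vs : k.-tuple 'rV[R]_n), (k <= r)%N -> C x ->
    (forall i, `|tnth vs i| <= 1) -> `|kderiv (h \o chart_inv c) (c x) vs| <= M.
Proof.
move=> sh cC Cc; have cC' : compact (c @` C).
  apply: continuous_compact cC.
  exact: continuous_subspaceW Cc (@chart_map_continuous _ _ _ c).
have oc := @chart_cod_open _ _ _ c.
have [|M MP] := boolp.choice (fun k => iterD_bounded k oc sh cC' _).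
  by move=> _ [x Cx <-]; exists x => //; exact: Cc.
exists (\sum_(k < r.+1) `|M k|) => k x vs kr Cx vs1.
rewrite (bigD1 (Ordinal (kr : (k < r.+1)%N))) //=.
apply: ler_wpDr; first exact: sumr_ge0.
apply: le_trans (ler_norm _); apply: MP; rewrite ?size_tuple //.
by move=> v /tnthP[i ->].
Qed.

Lemma segment_smooth (f g : Cinfty A) (s : R) :
  smooth_function A (fun x => f x + s * (g x - f x)).
Proof.
move=> c cA; have oc := @chart_cod_open _ _ _ c.
have sf := Cinfty_smooth f cA; have sg := Cinfty_smooth g cA.
have := smooth_on_lin s oc sf (smooth_on_lin (-1) oc sg sf).
by apply: smooth_on_eq => // w _; rewrite /= mulN1r.
Qed.

Definition segment (f g : Cinfty A) (s : R) : fine_very_strong A :=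
  MkCinfty (segment_smooth f g s).

Lemma diff_smooth (f g : Cinfty A) : smooth_function A (fun x => g x - f x).
Proof.
move=> c cA; have := smooth_on_lin (-1) (@chart_cod_open _ _ _ c)
  (Cinfty_smooth g cA) (Cinfty_smooth f cA).
by apply: smooth_on_eq (@chart_cod_open _ _ _ c) _ => w _; rewrite /= mulN1r.
Qed.

Lemma segment_kderivB (f g : Cinfty A) (c : @chart R n X) s t k x vs :
  maximal_atlas A c -> chart_dom c x ->
  @kderiv _ _ _ k (segment f g t \o chart_inv c) (c x) vs -
  kderiv (segment f g s \o chart_inv c) (c x) vs =
  (t - s) * kderiv ((fun x => g x - f x) \o chart_inv c) (c x) vs.
Proof.
move=> cA cx; apply/eqP; rewrite subr_eq addrC; apply/eqP.
have oc := @chart_cod_open _ _ _ c; have cc : chart_cod c (c x) by exists x.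
have sd := diff_smooth f g cA.
rewrite /kderiv -[_ * _](iterDZ _ vs oc sd cc).
rewrite -(iterDD _ oc (Cinfty_smooth (segment f g s) cA) _ cc); last first.
  exact: smooth_onZ.
by congr iterD; apply/funext => w /=; rewrite /GRing.scale /=; ring.
Qed.

(** Compactness of K is used through near_covering: it is enough to find, for
    each x in K, neighbourhoods of x and of s on which the estimates hold,
    and there only the finitely many i given by local finiteness matter. *)
Lemma segment_continuous (f g : Cinfty A) (K : set X) : hausdorff_space X ->
  compact K -> (forall x, ~ K x -> f x = g x) -> continuous (segment f g).
Proof.
move=> hX cK fgK; have oK : open (~` K).
  by rewrite openC; exact: compact_closed.
apply: continuous_to_fine_very_strong => [s B|s h].
  move=> [f0 [I [C [c [r [e [lf Cc ->]]]]]]] Bs.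
  have /boolp.choice[d dP] : forall i, exists d : R, 0 < d /\
      forall k, (k <= r i)%N ->
        (deriv_dist (C i) (c i) k (segment f g s) f0 + d%:E <= (e i)%:E)%E.
    move=> i; have [_ _ _ ei] := Cc i.
    by have [d d0 dk] := uniform_slack ei (Bs i); exists d.
  have /boolp.choice[M MP] : forall i, exists M,
      forall k x (vs : k.-tuple 'rV[R]_n), (k <= r i)%N -> C i x ->
      (forall i, `|tnth vs i| <= 1) ->
      `|kderiv ((fun x => g x - f x) \o chart_inv (c i)) (c i x) vs| <= M.
    move=> i; have [cC cA Cd _] := Cc i.
    by apply: kderiv_bounded => //; exact: diff_smooth.
  (* Pointwise bounds only give weak bounds on suprema; half of the slack d i
     keeps the final estimate strict. *)
  pose N t i k x := multilin_norm (fun vs : k.-tuple 'rV[R]_n =>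
    kderiv (segment f g t \o chart_inv (c i)) (c i x) vs -
    kderiv (segment f g s \o chart_inv (c i)) (c i x) vs).
  pose small t x := forall i k, (k <= r i)%N -> C i x ->
    (N t i k x <= (d i / 2)%:E)%E.
  have smallK : \forall t \near s, K `<=` small t.
    have /compact_near_coveringP nK := cK; apply: (nK _ (nbhs s) small) => x Kx.
    have [U xU fU] := lf x.
    pose V := [set t | forall i, [set i | C i `&` U !=set0] i ->
                         `|t - s| * M i <= d i / 2].
    exists (U, V); first split=> //=.
      apply: (near_finite_set (F := nbhs s)
        (P := fun i t => `|t - s| * M i <= d i / 2) _ fU _) => i _.
      have c0 : (fun t : R => `|t - s| * M i) @ s --> (0 : R).
        have -> : 0 = `|s - s| * M i by rewrite subrr normr0 mul0r.
        apply: cvgMr_tmp; apply: cvg_norm.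
        by apply: cvgB; [exact: cvg_id|exact: cvg_cst].
      have [d0 _] := dP i; apply: (cvgr_le _ c0); exact: divr_gt0.
    move=> [y t] [/= Uy Vt] i k kr Cy; apply: ge_ereal_sup => _ [vs vs1 <-].
    have [_ cA Cd _] := Cc i.
    rewrite lee_fin segment_kderivB //; last exact: Cd.
    rewrite normrM; apply: le_trans (Vt i _); last by exists y.
    by apply: ler_wpM2l => //; exact: MP.
  apply: filterS smallK => t smallt i k kr.
  have [_ cA Cd _] := Cc i.
  have dt : (deriv_dist (C i) (c i) k (segment f g t) (segment f g s)
             <= (d i / 2)%:E)%E.
    apply: ge_ereal_sup => _ [x Cx <-].
    have [Kx|Kx] := pselect (K x); first exact: smallt.
    have [d0 _] := dP i.
    apply: (@le_trans _ _ 0%E); last by rewrite lee_fin divr_ge0 // ltW.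
    apply: multilin_norm_le0 => vs.
    rewrite segment_kderivB //; last exact: Cd.
    rewrite (kderiv_eq0 _ oK) ?mulr0 //; last exact: Cd.
    by move=> y Ky; rewrite (fgK y Ky) subrr.
  apply: le_lt_trans (deriv_dist_triangle _ _ _ _ (segment f g s) _) _.
  have [d0 /(_ k kr)] := dP i; have := Bs i k kr.
  move: dt; case: (deriv_dist _ _ _ _ f0) => [y| |] //.
    move=> dt _; rewrite -EFinD lee_fin => yd.
    apply: (@le_lt_trans _ _ ((d i / 2)%:E + y%:E)%E); first exact: leeD.
    rewrite -EFinD lte_fin; lra.
  by move=> _ _ _; rewrite addeNy ltNyr.
move=> [L cL sL]; apply: filterE => t; exists (K `|` L); first exact: compactU.
move=> x /= tx; apply: contrapT => /not_orP[Kx Lx]; apply: Lx; apply: sL => /=.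
by move: tx; rewrite (fgK x Kx) !subrr !mulr0.
Qed.

End fine_very_strong_topology.

(** * The group of the cylinder over the sphere *)

Lemma RxS2_hausdorff (R : realType) : hausdorff_space (@RxS2 R).
Proof.
apply: (@hausdorff_injective _ (R * 'rV[R]_3)%type
  (fun x : RxS2 => (x.1, val x.2))).
- have c2 : continuous (fun x : RxS2 => val x.2 : 'rV[R]_3).
    move=> x; apply: (@continuous_comp _ _ _ snd
      (fun z : set_type sphere2 => val z)).
      exact: cvg_snd.
    exact: initial_continuous.
  move=> x; have c1 : {for x, continuous (fst : RxS2 -> R)} by exact: cvg_fst.
  exact: cvg_pair c1 (c2 x).
- by move=> [t z] [t' z'] [-> /val_inj ->].
- exact: (@norm_hausdorff _ (R * 'rV[R]_3)%type).
Qed.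

Theorem corollary1p4 (R : realType) :
  connected_component (@groupN R) (unitN R) = @groupNc R.
Proof.
apply/seteqP; split=> [F [C [C1 CN cC] CF]|F [NF [K cK FK]]].
  split; first exact: CN.
  have [oD cD] := differ_in_compact_clopen (unitN R).
  have CD : C `&` differ_in_compact (unitN R) = C.
    apply: cC; last by exists (differ_in_compact (unitN R)).
      exists (unitN R); split=> //.
      by exists set0; [exact: compact0|move=> x /=].
    by exists (differ_in_compact (unitN R)).
  move: CF; rewrite -CD => -[_ [K cK FK]]; exists K => // t z Kz.
  by apply: contrapT => Ft; apply: Kz; exact: FK.
have cs : continuous (segment (unitN R) F).
  apply: segment_continuous (@RxS2_hausdorff R) cK _ => -[t z] Kz.
  by rewrite FK.
have ext (G H : Cinfty (@RxS2_atlas R)) : (forall x, G x = H x) -> G = H.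
  case: G H => [G Gs] [H Hs] /= /funext GH.
  by subst; congr MkCinfty; exact: Prop_irrelevance.
exists (segment (unitN R) F @` `[0, 1]); last first.
  exists 1; first by rewrite /= in_itv /= ler01 lexx.
  by apply: ext => x /=; rewrite mul1r addrC subrK.
split.
- exists 0; first by rewrite /= in_itv /= ler01 lexx.
  by apply: ext => x /=; rewrite mul0r addr0.
- move=> _ [s s01 <-] z; apply: (@Diff_plus_segment _ (fun t => F (t, z))).
    by move: s01; rewrite /= in_itv.
  exact: NF.
- apply: connected_continuous_connected; first exact: segment_connected.
  exact: continuous_subspaceT.
Qed.
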